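(* For every finite $n\ge 2$, $RSA_n=SA_n$; that is, the class of (isomorphic copies of) subalgebras of direct products of full substitution set algebras with transpositions of dimension $n$ is exactly the variety axiomatized by $\Sigma_n$.
   Context: For distinct $i,j<n$, $[i,j]$ is the transposition of $n=\{0,\dots,n-1\}$ swapping $i$ and $j$, and $[i|j]$ is the map $n\to n$ sending $i$ to $j$ and fixing everything else. For a set $U$, the full substitution set algebra with transpositions of dimension $n$ and base $U$ is $\langle\mathcal P({}^nU);\cap,\sim,S^i_j,S_{ij}\rangle_{i\ne j\in n}$, where $\sim$ is complement in ${}^nU$, $S^i_j(X)=\{q\in{}^nU: q\circ[i|j]\in X\}$ and $S_{ij}(X)=\{q\in{}^nU: q\circ[i,j]\in X\}$. $SetSA_n$ is the class of all (isomorphic copies of) subalgebras of such full algebras, and $RSA_n=\mathbf{SP}\,SetSA_n$ (closure under isomorphic copies is understood). Abstract algebras have the type $\{\cdot,-,s^i_j,s_{ij}\}_{i\neq j\in n}$, with $s^i_j$ corresponding to $[i|j]$ and $s_{ij}$ to $[i,j]$. $SA_n=\mathbf{Mod}(\Sigma_n)$, where $\Sigma_n$ is the following finite set of equations: (a) the Boolean algebra axioms; (b) each $s_{ij}$ and each $s^i_j$ is a Boolean endomorphism; (c) for a fixed finite presentation of the monoid ${}^nn$ (all maps $n\to n$ under composition) in the generators $[i,j],[i|j]$, all equations $s_{g_1}\cdots s_{g_m}x=s_{h_1}\cdots s_{h_k}x$ for the defining relations $g_1\circ\cdots\circ g_m=h_1\circ\cdots\circ h_k$, where $s_{[i,j]}=s_{ij}$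 and $s_{[i|j]}=s^i_j$. (The class does not depend on the choice of presentation.) *)

(* Defs.v *)
From Stdlib Require List.
From mathcomp Require Import all_boot all_order all_fingroup.
From mathcomp Require Import boolp classical_sets.

Set Implicit Arguments.
Unset Strict Implicit.
Unset Printing Implicit Defensive.

Local Open Scope classical_set_scope.

Definition offdiag (n : nat) := {p : 'I_n * 'I_n | p.1 != p.2}.

(* [Repl (i, j)] stands for [i|j] (and, as an operation symbol, for s^i_j);
   [Transp (i, j)] stands for [i,j] (and for s_ij). The symbols s_ij and s_ji
   are distinct; they are identified only through the defining relations. *)
Inductive gen (n : nat) : Type :=
| Repl of offdiag n
| Transp of offdiag n.

Definition gens (n : nat) : seq (gen n) :=
  [seq Repl p | p <- enum {: offdiag n}]
    ++ [seq Transp p | p <- enum {: offdiag n}].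

Definition gen_map n (g : gen n) : 'I_n -> 'I_n :=
  match g with
  | Repl p => fun k => if k == (val p).1 then (val p).2 else k
  | Transp p => fun k => tperm (val p).1 (val p).2 k
  end.

(* The word g1 ... gm denotes the map g1 \o ... \o gm. *)
Definition word (n : nat) := seq (gen n).

Definition word_map n (w : word n) : 'I_n -> 'I_n :=
  foldr (fun g f => gen_map g \o f) id w.

Definition relations (n : nat) := seq (word n * word n).

Inductive monoid_cong n (R : relations n) : word n -> word n -> Prop :=
| mc_rel v w : List.In (v, w) R -> monoid_cong R v w
| mc_refl w : monoid_cong R w w
| mc_sym v w : monoid_cong R v w -> monoid_cong R w v
| mc_trans u v w :
    monoid_cong R u v -> monoid_cong R v w -> monoid_cong R u w
| mc_cat v v' w w' :
    monoid_cong R v v' -> monoid_cong R w w' ->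
    monoid_cong R (v ++ w) (v' ++ w').

(* R presents the monoid of all maps n -> n in the generators [i|j], [i,j]:
   word_map induces an isomorphism from the quotient of the free monoid by the
   congruence generated by R. *)
Definition is_presentation n (R : relations n) : Prop :=
  (forall f : 'I_n -> 'I_n, exists w, word_map w =1 f) /\
  (forall v w : word n, monoid_cong R v w <-> word_map v =1 word_map w).

Record alg (n : nat) : Type := Alg {
  carrier :> Type;
  meet : carrier -> carrier -> carrier;
  compl : carrier -> carrier;
  sub : gen n -> carrier -> carrier;
  carrier_nonempty : inhabited carrier }.

Definition is_hom n (A B : alg n) (h : A -> B) : Prop :=
  [/\ forall x y, h (meet x y) = meet (h x) (h y),
      forall x, h (compl x) = compl (h x)
    & forall g x, h (sub g x) = sub g (h x)].

Definition isomorphic n (A B : alg n) : Prop :=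
  exists h : A -> B, is_hom h /\ bijective h.

Record subuniverse n (B : alg n) (X : set B) : Prop := Subuniverse {
  subu_nonempty : X !=set0;
  subu_meet : forall x y, X x -> X y -> X (meet x y);
  subu_compl : forall x, X x -> X (compl x);
  subu_sub : forall g x, X x -> X (sub g x) }.

Lemma subalg_nonempty n (B : alg n) (X : set B) (HX : subuniverse X) :
  inhabited {x : B | X x}.
Proof. by case: (subu_nonempty HX) => x Xx; exists; exists x. Qed.

Definition subalg n (B : alg n) (X : set B) (HX : subuniverse X) : alg n :=
  @Alg n {x : B | X x}
    (fun x y => exist X _ (subu_meet HX (proj2_sig x) (proj2_sig y)))
    (fun x => exist X _ (subu_compl HX (proj2_sig x)))
    (fun g x => exist X _ (subu_sub HX g (proj2_sig x)))
    (subalg_nonempty HX).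

Lemma prodalg_nonempty n (I : Type) (B : I -> alg n) :
  inhabited (forall i, B i).
Proof.
have E i : exists x : B i, True by case: (carrier_nonempty (B i)) => x; exists x.
by exists => i; case: (cid (E i)).
Qed.

Definition prodalg n (I : Type) (B : I -> alg n) : alg n :=
  @Alg n (forall i, B i)
    (fun x y i => meet (x i) (y i))
    (fun x i => compl (x i))
    (fun g x i => sub g (x i))
    (prodalg_nonempty B).

Definition alg_class (n : nat) := alg n -> Prop.

(* Both class operators include closure under isomorphic copies. *)
Definition class_S n (K : alg_class n) : alg_class n := fun A =>
  exists (B : alg n) (X : set B) (HX : subuniverse X),
    K B /\ isomorphic A (subalg HX).

Definition class_P n (K : alg_class n) : alg_class n := fun A =>
  exists (I : Type) (B : I -> alg n),
    (forall i, K (B i)) /\ isomorphic A (prodalg B).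

Definition fullSetSA (n : nat) (U : Type) : alg n :=
  @Alg n (set ('I_n -> U))
    (fun X Y => X `&` Y)
    (fun X => ~` X)
    (fun g X => [set q : 'I_n -> U | X (q \o gen_map g)])
    (inhabits set0).

Definition SetSA (n : nat) : alg_class n :=
  class_S (fun A => exists U : Type, A = fullSetSA n U).

Definition RSA (n : nat) : alg_class n := class_S (class_P (@SetSA n)).

Inductive term (n : nat) : Type :=
| Var of nat
| Meet of term n & term n
| Compl of term n
| Sub of gen n & term n.

Definition equation (n : nat) := (term n * term n)%type.

Fixpoint eval n (A : alg n) (v : nat -> A) (t : term n) : A :=
  match t with
  | Var k => v k
  | Meet t1 t2 => meet (eval v t1) (eval v t2)
  | Compl t1 => compl (eval v t1)
  | Sub g t1 => sub g (eval v t1)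
  end.

Definition Mod n (S : seq (equation n)) : alg_class n := fun A =>
  forall e, List.In e S -> forall v : nat -> A, eval v e.1 = eval v e.2.

Definition Join n (s t : term n) : term n := Compl (Meet (Compl s) (Compl t)).

(* Distributive lattice axioms for meet and the De Morgan dual join; the last
   two equations say that x . -x is the least and x + -x the greatest element.
   Together they axiomatize Boolean algebras in the signature {., -}. *)
Definition boolean_axioms n : seq (equation n) :=
  let x := Var n 0 in let y := Var n 1 in let z := Var n 2 in
  [:: (Meet x y, Meet y x);
      (Join x y, Join y x);
      (Meet x (Meet y z), Meet (Meet x y) z);
      (Join x (Join y z), Join (Join x y) z);
      (Meet x (Join x y), x);
      (Join x (Meet x y), x);
      (Meet x (Join y z), Join (Meet x y) (Meet x z));
      (Join x (Meet y z), Meet (Join x y) (Join x z));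
      (Meet (Meet x (Compl x)) y, Meet x (Compl x));
      (Meet (Join x (Compl x)) y, y)].

Definition endo_axioms n : seq (equation n) :=
  let x := Var n 0 in let y := Var n 1 in
  [seq (Sub g (Meet x y), Meet (Sub g x) (Sub g y)) | g <- gens n]
    ++ [seq (Sub g (Compl x), Compl (Sub g x)) | g <- gens n].

Definition word_term n (w : word n) (t : term n) : term n := foldr (@Sub n) t w.

Definition relation_axioms n (R : relations n) : seq (equation n) :=
  [seq (word_term r.1 (Var n 0), word_term r.2 (Var n 0)) | r <- R].

Definition Sigma n (R : relations n) : seq (equation n) :=
  boolean_axioms n ++ endo_axioms n ++ relation_axioms R.

Definition SA n (R : relations n) : alg_class n := Mod (Sigma R).

(* Finite presentations in the above sense exist. *)

Lemma word_map_cat n (v w : word n) :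
  word_map (v ++ w) =1 word_map v \o word_map w.
Proof. by elim: v => [|g v IH] x //=; rewrite IH. Qed.

Lemma word_map_perm n (s : {perm 'I_n}) : exists w : word n, word_map w =1 s.
Proof.
have [ts -> ts_d] := prod_tpermP s.
elim: ts ts_d => [_|t ts IH /= /andP[td /IH[w Hw]]].
  by exists [::] => x; rewrite big_nil permE.
exists (w ++ [:: Transp (exist _ t td)]) => x.
by rewrite word_map_cat big_cons permM /= Hw.
Qed.

Lemma word_map_surj n (f : 'I_n -> 'I_n) : exists w : word n, word_map w =1 f.
Proof.
have [m] := ubnP (n - #|[set f x | x in 'I_n]%SET|).
elim: m f => // m IH f Hm.
have [/injectiveP fI|/injectivePn[a [b ab fab]]] := boolP (injectiveb f).
  by have [w Hw] := word_map_perm (perm fI); exists w => x; rewrite Hw permE.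
have imlt : #|[set f x | x in 'I_n]%SET| < n.
  rewrite ltn_neqAle -[X in _ <= X]card_ord leq_imset_card andbT.
  apply/negP => /eqP E; move/negP: ab; apply; apply/eqP.
  have /imset_injP fI : #|[set f x | x in 'I_n]%SET| == #|'I_n|.
    by rewrite E card_ord.
  exact: fI.
have [c cf] : exists c, c \notin [set f x | x in 'I_n]%SET.
  apply/existsP; rewrite -negb_forall; apply/negP => /forallP H.
  have E : [set f x | x in 'I_n]%SET = [set: 'I_n]%SET.
    by apply/finset.setP => y; rewrite H inE.
  by move: imlt; rewrite E cardsT card_ord ltnn.
have cfx x : f x != c by apply: contraNneq cf => <-; apply: imset_f.
pose f' x := if x == a then c else f x.
have [w Hw] : exists w : word n, word_map w =1 f'.
  apply: IH.
  have sub_im : (c |: [set f x | x in 'I_n])%SET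
                  \subset [set f' x | x in 'I_n]%SET.
    apply/fintype.subsetP => y; rewrite in_setU1 => /orP[/eqP->|/imsetP[x _ ->]].
      by apply/imsetP; exists a; rewrite // /f' eqxx.
    have [->|xa] := eqVneq x a.
      by apply/imsetP; exists b; rewrite // /f' eq_sym (negbTE ab).
    by apply/imsetP; exists x; rewrite // /f' (negbTE xa).
  have := subset_leq_card sub_im; rewrite cardsU1 cf /= add1n => lt.
  apply: leq_trans (_ : n - #|[set f x | x in 'I_n]%SET| <= m); last first.
    by rewrite -ltnS.
  exact: ltn_sub2l.
have cb : (c, f b).1 != (c, f b).2 by rewrite /= eq_sym.
exists (Repl (exist _ (c, f b) cb) :: w) => x /=.
rewrite Hw /f'; have [->|xa] := eqVneq x a; first by rewrite eqxx.
by rewrite (negbTE (cfx x)).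
Qed.

Lemma mem_gens n (g : gen n) : List.In g (gens n).
Proof.
have I (T : eqType) (h : T -> gen n) s x : x \in s -> List.In (h x) (map h s).
  elim: s => //= y s IH; rewrite inE => /orP[/eqP->|/IH]; first by left.
  by right.
apply: List.in_or_app.
by case: g => p; [left|right]; apply: I; rewrite mem_enum.
Qed.

Lemma presentation_exists n : exists R : relations n, is_presentation R.
Proof.
have /choice[W HW] (f : {ffun 'I_n -> 'I_n}) : exists w : word n, word_map w =1 f.
  exact: word_map_surj.
pose F (f : 'I_n -> 'I_n) : {ffun 'I_n -> 'I_n} := [ffun x => f x].
pose R : relations n := (W (F id), [::]) ::
  flatten [seq [seq (g :: W f, W (F (gen_map g \o f))) | g <- gens n]
          | f <- enum {ffun 'I_n -> 'I_n}].
have Rin r : List.In r R -> word_map r.1 =1 word_map r.2.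
  case=> [<- x|]; first by rewrite HW ffunE.
  elim: (enum {ffun 'I_n -> 'I_n}) => //= f s IH.
  move=> H; case: (List.in_app_or _ _ _ H) => {H}; last exact: IH.
  by elim: (gens n) => //= g t IHt [<- x /=|//]; rewrite !HW ffunE.
have nf w : monoid_cong R w (W (F (word_map w))).
  elim: w => [|g w IH]; first by apply/mc_sym/mc_rel; left.
  apply: (mc_trans (v := g :: W (F (word_map w)))).
    exact: (mc_cat (mc_refl R [:: g]) IH).
  have -> : F (word_map (g :: w)) = F (gen_map g \o F (word_map w)).
    by apply/ffunP => x; rewrite !ffunE /= !ffunE.
  apply: mc_rel; right.
  have : F (word_map w) \in enum {ffun 'I_n -> 'I_n} by rewrite mem_enum.
  elim: (enum {ffun 'I_n -> 'I_n}) => //= f s IHs; rewrite inE => /orP[/eqP<-|/IHs]; last first.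
    by move=> ?; apply: List.in_or_app; right.
  apply: List.in_or_app; left.
  exact: (List.in_map (fun g => (g :: W _, W (F (gen_map g \o _))))) (mem_gens g).
exists R; split; first exact: word_map_surj.
move=> v w; split.
  elim=> {v w} [v w /Rin //|//|v w _ IH x|u v w _ IH1 _ IH2 x|v v' w w' _ IH1 _ IH2 x].
  - by rewrite IH.
  - by rewrite IH1 IH2.
  - by rewrite !word_map_cat /= IH1 IH2.
move=> E; apply: mc_trans (nf v) _.
have -> : F (word_map v) = F (word_map w) by apply/ffunP => x; rewrite !ffunE E.
exact: mc_sym.
Qed.

(* Main.v *)
(** An algebra [A] in [SA] carries an action [s_f] of the full transformation
    monoid of [n] by Boolean endomorphisms, with [s_f s_g = s_(f \o g)]. Hence
    every ultrafilter [F] of the Boolean reduct of [A] yields a homomorphism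
    [a |-> {f : n -> n | s_f a \in F}] into the full algebra with base [n]
    itself. Taking [f = id], the homomorphisms for all ultrafilters [F]
    separate the points of [A], so that [A] embeds into a power of the full
    algebra with base [n]. *)
Require Import Defs.
From mathcomp Require Import all_boot.
From mathcomp Require Import boolp classical_sets.

Set Implicit Arguments.
Unset Strict Implicit.
Unset Printing Implicit Defensive.

Local Open Scope classical_set_scope.

(** * Homomorphisms and equational classes *)

Lemma is_hom_comp n (A B C : alg n) (g : B -> C) (f : A -> B) :
  is_hom g -> is_hom f -> is_hom (g \o f).
Proof.
move=> [gM gC gS] [fM fC fS]; split=> [x y|x|e x] /=.
- by rewrite fM gM.
- by rewrite fC gC.
- by rewrite fS gS.
Qed.

Lemma is_hom_subalg n (B : alg n) (X : set B) (HX : subuniverse X) :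
  is_hom (fun x : subalg HX => proj1_sig x).
Proof. by []. Qed.

Lemma is_hom_proj n (I : Type) (B : I -> alg n) i :
  is_hom (fun x : prodalg B => x i).
Proof. by []. Qed.

Lemma eval_hom n (A B : alg n) (h : A -> B) (v : nat -> A) t :
  is_hom h -> h (eval v t) = eval (h \o v) t.
Proof.
move=> [hM hC hS]; elim: t => //= [t IHt u IHu|t IH|g t IH].
- by rewrite hM IHt IHu.
- by rewrite hC IH.
- by rewrite hS IH.
Qed.

(** Homomorphisms commute with [eval], so both sides of an equation have the same image under every
    [h i], and separation makes them equal. Subalgebras (one inclusion) and products (all
    projections) are both instances. *)
Lemma Mod_separating n (S : seq (equation n)) (I : Type) (A : alg n)
    (B : I -> alg n) (h : forall i, A -> B i) :
  (forall i, is_hom (h i)) -> (forall x y, (forall i, h i x = h i y) -> x = y) ->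
  (forall i, Mod S (B i)) -> Mod S A.
Proof.
move=> hom sep BS e eS v; apply: sep => i.
by rewrite !eval_hom //; apply: BS.
Qed.

Lemma Mod_embedding n (S : seq (equation n)) (A B : alg n) (h : A -> B) :
  is_hom h -> injective h -> Mod S B -> Mod S A.
Proof.
move=> hom inj BS.
apply: (@Mod_separating _ _ unit A (fun=> B) (fun=> h)) => // x y E.
exact: inj (E tt).
Qed.

Lemma Mod_class_S n (S : seq (equation n)) (K : alg_class n) (A : alg n) :
  (forall B, K B -> Mod S B) -> class_S K A -> Mod S A.
Proof.
move=> KS [B [X [HX [KB [h [hom /bij_inj inj]]]]]].
apply: Mod_embedding (is_hom_comp (is_hom_subalg HX) hom) _ (KS _ KB).
by move=> x y /eq_sig_hprop E; apply/inj/E => ? ? ?; exact: Prop_irrelevance.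
Qed.

Lemma Mod_class_P n (S : seq (equation n)) (K : alg_class n) (A : alg n) :
  (forall B, K B -> Mod S B) -> class_P K A -> Mod S A.
Proof.
move=> KS [I [B [KB [h [hom /bij_inj inj]]]]].
apply: (@Mod_separating _ _ I A B (fun i a => h a i)).
- by move=> i; exact: is_hom_comp (is_hom_proj B i) hom.
- by move=> x y E; apply/inj/functional_extensionality_dep.
- by move=> i; exact/KS/KB.
Qed.

(** The subuniverse is the range of [h]; the inverse of the corestricted map is obtained by
    choice. *)
Lemma class_S_embedding n (K : alg_class n) (A B : alg n) (h : A -> B) :
  is_hom h -> injective h -> K B -> class_S K A.
Proof.
move=> hom inj KB; have [hM hC hS] := hom.
have HX : subuniverse (range h).
  split.
  - by have [a] := carrier_nonempty A; exists (h a), a.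
  - by move=> _ _ [x _ <-] [y _ <-]; exists (meet x y).
  - by move=> _ [x _ <-]; exists (compl x).
  - by move=> g _ [x _ <-]; exists (sub g x).
exists B, (range h), HX; split=> //.
pose h' (a : A) : subalg HX := exist _ (h a) (ex_intro2 _ _ a I erefl).
exists h'; split.
  by split=> *; apply: eq_exist; rewrite /= ?hM ?hC ?hS.
have pre (y : subalg HX) : exists a, h a = proj1_sig y.
  by case: y => y /= [a _ E]; exists a.
have [k hk] := choice pre.
exists k => [a|y]; first by apply: inj; rewrite hk.
by case: y (hk y) => y Xy /= E; exact: eq_exist.
Qed.

Lemma class_P_prodalg n (K : alg_class n) (I : Type) (B : I -> alg n) :
  (forall i, K (B i)) -> class_P K (prodalg B).
Proof.
move=> KB; exists I, B; split=> //; exists id; split=> //.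
by exists id.
Qed.

Lemma SetSA_fullSetSA n (U : Type) : SetSA (fullSetSA n U).
Proof. by apply: (@class_S_embedding _ _ _ _ id) => //; exists U. Qed.

(** * The action of words *)

Definition act n (A : alg n) (w : word n) (x : A) : A :=
  foldr (fun g => sub g) x w.

Lemma eval_word_term n (A : alg n) (v : nat -> A) w t :
  eval v (word_term w t) = act w (eval v t).
Proof. by elim: w => //= g w ->. Qed.

Lemma act_cat n (A : alg n) (v w : word n) (x : A) :
  act (v ++ w) x = act v (act w x).
Proof. exact: foldr_cat. Qed.

(** The outermost operation is the first to be composed onto [q] on the right, so the word is read
    in the same order as in [word_map]. *)
Lemma act_fullSetSA n U (w : word n) (X : fullSetSA n U) :
  act w X = [set q : 'I_n -> U | X (q \o word_map w)].
Proof. by elim: w => //= g w ->. Qed.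

Lemma In_cat (T : Type) (x : T) (s t : seq T) :
  List.In x (s ++ t) <-> List.In x s \/ List.In x t.
Proof. exact: List.in_app_iff. Qed.

Lemma in_Sigma n (R : relations n) e : List.In e (Sigma R) <->
  [\/ List.In e (boolean_axioms n), List.In e (endo_axioms n)
    | List.In e (relation_axioms R)].
Proof.
rewrite /Sigma !In_cat; split=> [[|[]]|[]]; last by right; right.
- by constructor 1.
- by constructor 2.
- by constructor 3.
- by left.
- by right; left.
Qed.

Section SigmaAlgebra.
Variables (n : nat) (R : relations n) (A : alg n).
Hypotheses (R_pres : is_presentation R) (SA_A : SA R A).

Lemma SA_boolean e (v : nat -> A) :
  List.In e (boolean_axioms n) -> eval v e.1 = eval v e.2.
Proof. by move=> H; apply/SA_A/in_Sigma; constructor 1. Qed.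

Lemma sub_meet g (x y : A) : sub g (meet x y) = meet (sub g x) (sub g y).
Proof.
pose e h := (Defs.Sub h (Meet (Var n 0) (Var n 1)),
             Meet (Defs.Sub h (Var n 0)) (Defs.Sub h (Var n 1))).
apply: (SA_A (e := e g) _ (fun k => if k == 0 then x else y)).
apply/in_Sigma; constructor 2; apply/In_cat.
by left; apply: (List.in_map e); exact: mem_gens.
Qed.

Lemma sub_compl g (x : A) : sub g (compl x) = compl (sub g x).
Proof.
pose e h := (Defs.Sub h (Compl (Var n 0)), Compl (Defs.Sub h (Var n 0))).
apply: (SA_A (e := e g) _ (fun=> x)).
apply/in_Sigma; constructor 2; apply/In_cat.
by right; apply: (List.in_map e); exact: mem_gens.
Qed.

Lemma act_meet w (x y : A) : act w (meet x y) = meet (act w x) (act w y).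
Proof. by elim: w => //= g w ->; rewrite sub_meet. Qed.

Lemma act_compl w (x : A) : act w (compl x) = compl (act w x).
Proof. by elim: w => //= g w ->; rewrite sub_compl. Qed.

(** This makes the operation of a map independent of the word chosen for it. Equal maps have
    congruent words, and each rule of the congruence preserves the action: defining relations are
    axioms of [Sigma R], and concatenation is composition. *)
Lemma act_word_map v w (x : A) : word_map v =1 word_map w -> act v x = act w x.
Proof.
move/(R_pres.2 v w) => vw; elim: vw x => {v w}.
- move=> v w vw x.
  pose e (r : word n * word n) :=
    (word_term r.1 (Var n 0), word_term r.2 (Var n 0)).
  have : eval (fun=> x) (e (v, w)).1 = eval (fun=> x) (e (v, w)).2.
    apply/SA_A/in_Sigma; constructor 3.
    exact: (List.in_map e).
  by rewrite !eval_word_term.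
- by [].
- by move=> v w _ IH x; rewrite IH.
- by move=> u v w _ IHu _ IHv x; rewrite IHu IHv.
- by move=> v v' w w' _ IHv _ IHw x; rewrite !act_cat IHw IHv.
Qed.

(** * Ultrafilters *)

Let join (x y : A) := compl (meet (compl x) (compl y)).
Let val3 (x y z : A) k := if k == 0 then x else if k == 1 then y else z.

Lemma meetC (x y : A) : meet x y = meet y x.
Proof.
by apply: (@SA_boolean (Meet (Var n 0) (Var n 1), Meet (Var n 1) (Var n 0))
  (val3 x y y)) => /=; do ?[by left | right].
Qed.

Lemma meetA (x y z : A) : meet x (meet y z) = meet (meet x y) z.
Proof.
by apply: (@SA_boolean (Meet (Var n 0) (Meet (Var n 1) (Var n 2)),
  Meet (Meet (Var n 0) (Var n 1)) (Var n 2))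
  (val3 x y z)) => /=; do ?[by left | right].
Qed.

Lemma meetKj (x y : A) : meet x (join x y) = x.
Proof.
by apply: (@SA_boolean (Meet (Var n 0) (Join (Var n 0) (Var n 1)), Var n 0)
  (val3 x y y)) => /=; do ?[by left | right].
Qed.

Lemma joinKm (x y : A) : join x (meet x y) = x.
Proof.
by apply: (@SA_boolean (Join (Var n 0) (Meet (Var n 0) (Var n 1)), Var n 0)
  (val3 x y y)) => /=; do ?[by left | right].
Qed.

Lemma joinC (x y : A) : join x y = join y x.
Proof. by rewrite /join meetC. Qed.

Lemma meet_joinr (x y z : A) :
  meet x (join y z) = join (meet x y) (meet x z).
Proof.
by apply: (@SA_boolean (Meet (Var n 0) (Join (Var n 1) (Var n 2)),
  Join (Meet (Var n 0) (Var n 1)) (Meet (Var n 0) (Var n 2)))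
  (val3 x y z)) => /=; do ?[by left | right].
Qed.

Lemma meet_complK (x y : A) : meet (meet x (compl x)) y = meet x (compl x).
Proof.
by apply: (@SA_boolean
  (Meet (Meet (Var n 0) (Compl (Var n 0))) (Var n 1),
   Meet (Var n 0) (Compl (Var n 0)))
  (val3 x y y)) => /=; do ?[by left | right].
Qed.

Lemma join_complK (x y : A) : meet (join x (compl x)) y = y.
Proof.
by apply: (@SA_boolean
  (Meet (Join (Var n 0) (Compl (Var n 0))) (Var n 1), Var n 1)
  (val3 x y y)) => /=; do ?[by left | right].
Qed.

Lemma meetxx (x : A) : meet x x = x.
Proof. by rewrite -{2}[x](joinKm x x) meetKj. Qed.

(** The signature has no constant for the bottom element; by this lemma any [meet x (compl x)] can
    stand for it. *)
Lemma meet_compl_const (x y : A) : meet x (compl x) = meet y (compl y).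
Proof. by rewrite -(meet_complK x (meet y (compl y))) meetC meet_complK. Qed.

Lemma join_bot (x y : A) : join (meet y (compl y)) x = x.
Proof. by rewrite (meet_compl_const y x) joinC joinKm. Qed.

(** Split [x] as the join of [meet x y] and [meet x (compl y)]; the second part is bottom. *)
Lemma meet_bot_le (x y : A) :
  meet x (compl y) = meet x (compl x) -> meet x y = x.
Proof.
by move=> E; rewrite -[RHS](join_complK y) [RHS]meetC meet_joinr E joinC join_bot.
Qed.

Lemma meet_bot_le_compl (x y : A) :
  meet x y = meet x (compl x) -> meet x (compl y) = x.
Proof. by move=> E; rewrite -[RHS](join_complK y) [RHS]meetC meet_joinr E join_bot. Qed.

Let le (x y : A) := meet x y = x.

Lemma le_trans (y x z : A) : le x y -> le y z -> le x z.
Proof. by rewrite /le => xy yz; rewrite -xy -meetA yz. Qed.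

Lemma le_meetl (x y : A) : le (meet x y) x.
Proof. by rewrite /le meetC meetA meetxx. Qed.

Lemma le_meetr (x y : A) : le (meet x y) y.
Proof. by rewrite meetC; exact: le_meetl. Qed.

Lemma le_meet (x y z : A) : le z x -> le z y -> le z (meet x y).
Proof. by rewrite /le => zx zy; rewrite meetA zx. Qed.

Definition proper_filter (F : set A) :=
  [/\ forall x y, F x -> F y -> F (meet x y),
      forall x y, le x y -> F x -> F y
    & forall x, ~ F (meet x (compl x))].

(** Stated as the condition that membership in [F] is a Boolean homomorphism to truth values, which
    is the form the representation uses. *)
Definition ultrafilter (F : set A) :=
  (forall x y, F (meet x y) <-> F x /\ F y) /\ (forall x, F (compl x) <-> ~ F x).

Lemma maximal_proper_filter (c : A) : c <> meet c (compl c) ->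
  exists F : set A, [/\ proper_filter F, F c
    & forall G, proper_filter G -> F `<=` G -> G `<=` F].
Proof.
move=> c0.
have c_bot x : ~ le c (meet x (compl x)).
  by rewrite /le meetC meet_complK (meet_compl_const x c) => /esym.
(* Adjoining the up-set of [c] makes the empty set, the union of the empty
   chain, admissible. *)
pose P (F : set A) := proper_filter (F `|` le c).
have [C CP totC|F [PF maxF]] := @Zorn_bigcup A P.
  split.
  (* Two members of the chain are comparable, so both elements lie in the larger one together with
     the up-set of [c]. *)
  - move=> x y [[X CX Xx]|cx] [[Y CY Yy]|cy].
    + have [XY|YX] := totC X Y CX CY.
        have [/(_ x y (or_introl (XY _ Xx)) (or_introl Yy)) [] ? _ _] := CP _ CY.
          by left; exists Y.
        by right.
      have [/(_ x y (or_introl Xx) (or_introl (YX _ Yy))) [] ? _ _] := CP _ CX.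
        by left; exists X.
      by right.
    + have [/(_ x y (or_introl Xx) (or_intror cy)) [] ? _ _] := CP _ CX.
        by left; exists X.
      by right.
    + have [/(_ x y (or_intror cx) (or_introl Yy)) [] ? _ _] := CP _ CY.
        by left; exists Y.
      by right.
    + by right; exact: le_meet.
  - move=> x y xy [[X CX Xx]|cx]; last by right; exact: le_trans xy.
    have [_ /(_ x y xy (or_introl Xx)) [] ? _] := CP _ CX; last by right.
    by left; exists X.
  - move=> x [[X CX Xx]|/c_bot //].
    by have [_ _ /(_ x)] := CP _ CX; apply; left.
exists (F `|` le c); split=> //; first by right; exact: meetxx.
(* A point of [G] outside [F] would make [G] a strictly larger admissible set, since [G] already
   contains the up-set of [c]. *)
move=> G GF FG x Gx; left; apply: contrapT => Fx.
apply: (maxF G).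
  split; first by move=> y Fy; apply: FG; left.
  by move=> GF'; apply/Fx/GF'.
by rewrite /P setUidl // => y cy; apply: FG; right.
Qed.

Lemma ultrafilter_exists (c : A) : c <> meet c (compl c) ->
  exists2 F : set A, ultrafilter F & F c.
Proof.
move/maximal_proper_filter => [F [[FM FU F0] Fc maxF]].
exists F => //; split=> [x y|x].
  split; last by move=> []; exact: FM.
  by move=> Fxy; split; apply: FU Fxy; [exact: le_meetl|exact: le_meetr].
split=> [FCx Fx|NFx]; first exact: F0 (FM _ _ Fx FCx).
apply: contrapT => NFCx; apply: NFx.
(* This is the filter generated by [F] and [x]. It is proper: if [meet f x] were bottom with [f] in
   [F], then [f] would lie below [compl x], forcing [compl x] into [F]. *)
apply: (maxF [set y | exists2 f, F f & le (meet f x) y]).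
- split.
  + move=> y z [f Ff fy] [g Fg gz]; exists (meet f g); first exact: FM.
    apply: le_meet.
      apply: le_trans fy; apply: le_meet; last exact: le_meetr.
      by apply: le_trans (le_meetl _ _) _; exact: le_meetl.
    apply: le_trans gz; apply: le_meet; last exact: le_meetr.
    by apply: le_trans (le_meetl _ _) _; exact: le_meetr.
  + by move=> y z yz [f Ff fy]; exists f => //; exact: le_trans yz.
  + move=> y [f Ff]; rewrite /le meetC meet_complK (meet_compl_const y f).
    move=> /esym/meet_bot_le_compl fCx.
    by apply: NFCx; apply: FU Ff.
- by move=> f Ff; exists f => //; exact: le_meetl.
- by exists c => //; exact: le_meetr.
Qed.

Lemma ultrafilter_separates (a b : A) :
  (forall F, ultrafilter F -> F a <-> F b) -> a = b.
Proof.
have sub_le x y : (forall F, ultrafilter F -> F x -> F y) -> meet x y = x.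
  (* If [x] is not below [y], then [meet x (compl y)] is not bottom, and an ultrafilter containing
     it contains [x] but not [y]. *)
  move=> xy; apply: meet_bot_le; apply: contrapT => NE.
  have [|F uF] := @ultrafilter_exists (meet x (compl y)).
    by rewrite -(meet_compl_const x).
  have [FM FC] := uF.
  by move=> /FM[/(xy _ uF) Fy /FC].
move=> ab; rewrite -(sub_le a b) => [|F uF]; last exact: (ab F uF).1.
by rewrite meetC sub_le // => F uF; exact: (ab F uF).2.
Qed.

(** * Representation, and validity of the axioms in full algebras *)

Lemma SA_RSA : RSA A.
Proof.
have [W WK] := choice (@word_map_surj n).
pose B (F : {F : set A | ultrafilter F}) := fullSetSA n 'I_n.
pose h (a : A) : prodalg B := fun F f => proj1_sig F (act (W f) a).
apply: (@class_S_embedding _ _ _ (prodalg B) h).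
- split=> [x y|x|g x]; apply: functional_extensionality_dep => -[F uF];
    apply/funext => f; apply/propext; have [FM FC] := uF; rewrite /h /=.
  + by rewrite act_meet; exact: FM.
  + by rewrite act_compl; exact: FC.
  (* In the full algebra, [f] lies in the substituted set exactly when [f \o gen_map g] lies in the
     original one. *)
  + suff -> : act (W f) (sub g x) = act (W (f \o gen_map g)) x by [].
    rewrite -[act _ (sub g x)]/(act _ (act [:: g] x)) -act_cat.
    by apply: act_word_map => k; rewrite word_map_cat /= !WK.
- move=> a b hab; apply: ultrafilter_separates => F uF.
  have := congr1 (fun X : prodalg B => X (exist _ F uF) id) hab.
  (* The word chosen for [id] need not be empty, but it acts like the empty word. *)
  have idE (x : A) : act (W id) x = x.
    by rewrite -[RHS]/(act [::] x); apply: act_word_map => k; rewrite WK.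
  by rewrite /h /= !idE => ->.
- by apply: class_P_prodalg => F; exact: SetSA_fullSetSA.
Qed.

End SigmaAlgebra.

Lemma SA_fullSetSA n (R : relations n) U :
  is_presentation R -> SA R (fullSetSA n U).
Proof.
move=> R_pres e /in_Sigma[].
- move=> H v; apply: eq_set => q; apply: propext; move: H => /=.
  (* The Boolean axioms are checked pointwise at [q]; excluded middle for the three variables lets
     the intuitionistic [tauto] decide each one. *)
  have [[E0 E1] E2] := (EM ((v 0 : set _) q), EM ((v 1 : set _) q), EM ((v 2 : set _) q)).
  by do ?[case=> [<-|] /=; first by tauto].
- by move=> /In_cat[] /List.in_map_iff[g [<- _]].
- move=> /List.in_map_iff[[u w] [<- uw]] v; rewrite !eval_word_term !act_fullSetSA.
  have /funext -> // : word_map u =1 word_map w.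
  by apply/(R_pres.2 u w); exact: mc_rel.
Qed.

Theorem theorem2p13 (n : nat) (n_ge2 : 2 <= n)
    (R : relations n) (R_pres : is_presentation R) :
  forall A : alg n, RSA A <-> SA R A.
Proof.
move=> A; split; last exact: SA_RSA.
(* The equations pass through the subalgebra and product operators of [RSA], then through the
   subalgebra operator inside [SetSA]. *)
apply: Mod_class_S => B; apply: Mod_class_P => C; apply: Mod_class_S => D.
by case=> U ->; exact: SA_fullSetSA.
Qed.
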